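(* Let $\mathcal{H}$ be a Krein space with fundamental symmetry $J$, and let $Q_0\in\mathcal{Q}$ be a $J$-normal projection. Then the map $p_{Q_0}:\mathcal{U}_J\to\mathcal{U}_J\cdot Q_0$ given by $p_{Q_0}(U)=UQ_0U^{\#}$ has local continuous cross sections, where the orbit $\mathcal{U}_J\cdot Q_0=\{UQ_0U^{\#}:U\in\mathcal{U}_J\}$ is endowed with the norm topology inherited from $L(\mathcal{H})$. In particular, the quotient topology and the topology inherited from $L(\mathcal{H})$ are equivalent in $\mathcal{U}_J\cdot Q_0$.
   Context: $(\mathcal{H},\langle\cdot,\cdot\rangle)$ is a complex separable Hilbert space and $L(\mathcal{H})$ is the algebra of bounded operators on it. $J\in L(\mathcal{H})$ is a fixed symmetry ($J=J^*=J^{-1}$), and the Krein space structure is given by the indefinite inner product $[f,g]=\langle Jf,g\rangle$. For $T\in L(\mathcal{H})$ the $J$-adjoint is $T^{\#}=JT^*J$. The set of $J$-normal projections is $\mathcal{Q}=\{Q\in L(\mathcal{H}): Q^2=Q,\ QQ^{\#}=Q^{\#}Q\}$. The group of bounded $J$-unitary operators $\mathcal{U}_J=\{U\in L(\mathcal{H}):UU^{\#}=U^{\#}U=I\}$ carries the operator norm topology. The quotient topology on $\mathcal{U}_J\cdot Q_0$ is the one obtained by identifying $\mathcal{U}_J\cdot Q_0$ with $\mathcal{U}_J/\mathcal{G}$, where $\mathcal{G}=\{U\in\mathcal{U}_J:UQ_0=Q_0U\}$. A map $p:A\to B$ of topological spaces has local continuous cross sections if every point of $B$ has an open neighborhood $\mathcal{W}\subseteq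 B$ and a continuous map $s:\mathcal{W}\to A$ with $p\circ s=\mathrm{id}_{\mathcal{W}}$. *)

(* Defs.v *)
From HB Require Import structures.
From mathcomp Require Import all_boot all_order all_algebra.
From mathcomp Require Import all_classical all_reals all_analysis.
From mathcomp Require Import complex ring lra.

Set Implicit Arguments.
Unset Strict Implicit.
Unset Printing Implicit Defensive.

Import Order.TTheory GRing.Theory Num.Theory.
Import numFieldNormedType.Exports.

Local Open Scope classical_set_scope.
Local Open Scope complex_scope.
Local Open Scope ring_scope.
Local Open Scope quotient_scope.

(* A complex Hilbert space: the scalar product is linear in its first argument
   and the norm of the Banach space H is the one that it induces. *)
HB.mixin Record CompleteNormedModule_isHilbert (R : realType) (H : Type)
    of CompleteNormedModule R[i] H := {
  hdot : {dot H for (Num.conj : R[i] -> R[i])} ;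
  hdot_norm : forall f : H, hdot f f = `|f| ^+ 2
}.

#[short(type="hilbertType")]
HB.structure Definition Hilbert (R : realType) :=
  {H of CompleteNormedModule R[i] H & CompleteNormedModule_isHilbert R H}.

Definition separable_space (T : topologicalType) : Prop :=
  exists2 D : set T, countable D & dense D.

(* W : set B is used as a type below: it is then the subtype of B with the
   induced topology. *)
Definition has_local_cross_sections (A B : topologicalType) (p : A -> B) : Prop :=
  forall b : B, exists W : set B, [/\ open W, W b &
    exists2 s : W -> A, continuous s & forall w : W, p (s w) = set_val w].

Section RealPart.
Context (R : realType) (H : hilbertType R).
Implicit Types (f g h x y : H) (T : H -> H).

(* Norms of a normed module over R[i] lie in R[i]; rnorm and rdot are the real
   norm and the real scalar product. *)
Definition rnorm x : R := complex.Re `|x|.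
Definition rdot f g : R := complex.Re (hdot f g).

Lemma hdotC f g : hdot f g = Num.conj (hdot g f).
Proof. by have := hermC hdot f g; rewrite expr0 mul1r. Qed.

Lemma hdotDl f g h : hdot (f + g) h = hdot f h + hdot g h.
Proof. exact: linearDl. Qed.

Lemma hdotDr f g h : hdot f (g + h) = hdot f g + hdot f h.
Proof. exact: linearDr. Qed.

Lemma hdotNl f g : hdot (- f) g = - hdot f g.
Proof. exact: linearNl. Qed.

Lemma hdotNr f g : hdot f (- g) = - hdot f g.
Proof. exact: linearNr. Qed.

Lemma hdotZl (a : R[i]) f g : hdot (a *: f) g = a * hdot f g.
Proof. exact: linearZl_LR. Qed.

Lemma hdotZr (a : R[i]) f g : hdot f (a *: g) = Num.conj a * hdot f g.
Proof. exact: linearZr_LR. Qed.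

Lemma rnormE x : `|x| = (rnorm x)%:C.
Proof. by rewrite /rnorm RRe_real// normr_real. Qed.

Lemma rnorm_ge0 x : 0 <= rnorm x.
Proof. by rewrite -lecR -rnormE normr_ge0. Qed.

Lemma rnorm0 : rnorm 0 = 0.
Proof. by rewrite /rnorm normr0. Qed.

Lemma rnorm_eq0 x : rnorm x = 0 -> x = 0.
Proof. by move=> x0; apply/normr0_eq0; rewrite rnormE x0. Qed.

Lemma rnormD x y : rnorm (x + y) <= rnorm x + rnorm y.
Proof. by rewrite -lecR -rnormE rmorphD/= -!rnormE ler_normD. Qed.

Lemma rnormZ (r : R) x : rnorm (r%:C *: x) = `|r| * rnorm x.
Proof.
apply: complexI.
by rewrite -rnormE normrZ normc_def/= expr0n addr0 sqrtr_sqr rmorphM/= -rnormE.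
Qed.

Lemma rdotC f g : rdot f g = rdot g f.
Proof. by rewrite /rdot hdotC; case: (hdot g f : R[i]). Qed.

Lemma rdotDl f g h : rdot (f + g) h = rdot f h + rdot g h.
Proof. by rewrite /rdot hdotDl raddfD. Qed.

Lemma rdotDr f g h : rdot f (g + h) = rdot f g + rdot f h.
Proof. by rewrite !(rdotC f) rdotDl. Qed.

Lemma rdotZl (r : R) f g : rdot (r%:C *: f) g = r * rdot f g.
Proof.
by rewrite /rdot hdotZl; case: (hdot f g : R[i]) => a b /=; rewrite mul0r subr0.
Qed.

Lemma rdotZr (r : R) f g : rdot f (r%:C *: g) = r * rdot f g.
Proof. by rewrite rdotC rdotZl rdotC. Qed.

Lemma rdotNr f g : rdot f (- g) = - rdot f g.
Proof. by rewrite /rdot hdotNr raddfN. Qed.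

Lemma rdotff f : rdot f f = rnorm f ^+ 2.
Proof. by rewrite /rdot hdot_norm rnormE -rmorphXn. Qed.

Lemma rdot_CS f g : `|rdot f g| <= rnorm f * rnorm g.
Proof.
have [->|g0] := eqVneq g 0.
  by rewrite -[X in rdot f X](scale0r (0 : H)) rdotZr mul0r normr0 rnorm0 mulr0.
have ng : 0 < rnorm g.
  rewrite lt_neqAle rnorm_ge0 andbT eq_sym; apply: contraNneq g0.
  by move=> /rnorm_eq0 ->.
rewrite -(@ler_pXn2r _ 2)// ?nnegrE ?mulr_ge0 ?rnorm_ge0// real_normK ?num_real//.
have := sqr_ge0 (rnorm ((rdot g g)%:C *: f + (- rdot f g)%:C *: g)).
rewrite -rdotff !(rdotDl, rdotDr, rdotZl, rdotZr) (rdotC g f) !rdotff.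
set a := rnorm f; set b := rnorm g; set c := rdot f g => h.
have {}h : 0 <= b ^+ 2 * ((a * b) ^+ 2 - c ^+ 2) by lra.
by move: h; rewrite pmulr_rge0 ?exprn_gt0// subr_ge0.
Qed.

End RealPart.

Section BoundedOperators.
Context (R : realType) (H : hilbertType R).

Definition bounded_operator : {pred H -> H} :=
  mem [set T : H -> H | linear T /\ exists M, forall f, `|T f| <= M * `|f|].

Record bop := BOp { bop_fun : H -> H ; bop_funP : bop_fun \in bounded_operator }.
HB.instance Definition _ := [isSub for bop_fun].
HB.instance Definition _ := [Choice of bop by <:].

Lemma bounded_operator_submod : submod_closed bounded_operator.
Proof.
split=> [|a S T /set_mem[Sl [M SM]] /set_mem[Tl [N TN]]]; apply/mem_set.
  by split=> [b f g|]; [rewrite /= scaler0 addr0|exists 0 => f; rewrite normr0 mul0r].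
have STE f : (a *: S + T) f = a *: S f + T f by [].
split=> [b f g|].
  by rewrite !STE Sl Tl !scalerDr !scalerA [b * a]mulrC addrACA.
exists (`|a| * M + N) => f; rewrite STE mulrDl -mulrA.
by rewrite (le_trans (ler_normD _ _))// lerD// normrZ ler_wpM2l.
Qed.
HB.instance Definition _ := GRing.isSubmodClosed.Build R[i] (H -> H)
  bounded_operator bounded_operator_submod.
HB.instance Definition _ := [SubChoice_isSubLmodule of bop by <:].

End BoundedOperators.
Arguments bounded_operator {R} H.
Arguments bop {R} H.
Coercion bop_fun : bop >-> Funclass.
Notation "''L' ( H )" := (bop H) (format "''L' ( H )") : type_scope.

Section BoundedOperatorTheory.
Context (R : realType) (H : hilbertType R).
Implicit Types (S T U : 'L(H)) (f g h : H).

Lemma bopP S T : S =1 T -> S = T.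
Proof. by move=> ST; apply/val_inj/funext. Qed.

Lemma bop_linear T : linear T.
Proof. by case: T => T /= /set_mem[]. Qed.
HB.instance Definition _ T :=
  GRing.isLinear.Build R[i] H H _ (T : H -> H) (bop_linear T).

Lemma bop_bound T : exists2 M : R, 0 <= M & forall f, rnorm (T f) <= M * rnorm f.
Proof.
case: T => T /= /set_mem[_ [M TM]]; exists `|complex.Re M| => // f.
have := TM f; rewrite !rnormE; case: M {TM} => a b; rewrite lecE => /andP[_] /=.
rewrite mulr0 subr0 => /le_trans; apply.
by rewrite ler_wpM2r ?rnorm_ge0// ler_norm.
Qed.

Lemma bopDE S T f : (S + T) f = S f + T f. Proof. by []. Qed.
Lemma bopZE (a : R[i]) T f : (a *: T) f = a *: T f. Proof. by []. Qed.

Lemma comp_boundedP S T : S \o T \in bounded_operator H.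
Proof.
apply/mem_set; split=> [a f g|]; first by rewrite /= !linearP.
have [M M0 SM] := bop_bound S; have [N N0 TN] := bop_bound T.
exists (M * N)%:C => f; rewrite !rnormE -rmorphM lecR/=.
by rewrite (le_trans (SM _))// -mulrA ler_wpM2l.
Qed.

Lemma id_boundedP : (@id H) \in bounded_operator H.
Proof. by apply/mem_set; split=> //; exists 1 => f; rewrite mul1r. Qed.

Definition bop_comp S T := BOp (comp_boundedP S T).
Definition bop_id : 'L(H) := BOp id_boundedP.

Lemma bop_compA : associative bop_comp.
Proof. by move=> S T U; exact: bopP. Qed.
Lemma bop_comp1l : left_id bop_id bop_comp.
Proof. by move=> T; exact: bopP. Qed.
Lemma bop_comp1r : right_id bop_id bop_comp.
Proof. by move=> T; exact: bopP. Qed.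
Lemma bop_compDl : left_distributive bop_comp +%R.
Proof. by move=> S T U; exact: bopP. Qed.
Lemma bop_compDr : right_distributive bop_comp +%R.
Proof. by move=> S T U; apply: bopP => f; exact: (raddfD S (T f) (U f)). Qed.
HB.instance Definition _ := GRing.Zmodule_isPzRing.Build 'L(H)
  bop_compA bop_comp1l bop_comp1r bop_compDl bop_compDr.

Lemma bopME S T f : (S * T) f = S (T f). Proof. by []. Qed.
Lemma bop1E f : (1 : 'L(H)) f = f. Proof. by []. Qed.

(* The norm of the normed module 'L(H) below, hence the source of its topology. *)
Definition opnorm T : R[i] :=
  (sup [set complex.Re `|T f| | f in [set f : H | `|f| <= 1]])%:C.

Let unitball_neq0 T :
  [set complex.Re `|T f| | f in [set f : H | `|f| <= 1]] !=set0.
Proof. by exists (complex.Re `|T 0|), 0 => //=; rewrite normr0 ler01. Qed.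

Lemma opnorm_ub T f : `|T f| <= opnorm T * `|f|.
Proof.
have [M M0 TM] := bop_bound T.
have [->|f0] := eqVneq f 0; first by rewrite raddf0 !normr0 mulr0.
have nf0 : rnorm f != 0 by apply: contra_neq f0 => /rnorm_eq0.
have nf : 0 < rnorm f by rewrite lt_neqAle eq_sym nf0 rnorm_ge0.
rewrite !rnormE -rmorphM lecR.
rewrite -ler_pdivrMr//; apply: ub_le_sup.
  exists M => _ [g /= + <-]; rewrite rnormE lecR => g1.
  by rewrite (le_trans (TM g))// ler_piMr.
exists ((rnorm f)^-1%:C *: f).
  by rewrite /= rnormE rnormZ lecR ger0_norm ?invr_ge0 ?(ltW nf)// mulVf.
rewrite (linearZ_LR T) -/(rnorm _) rnormZ.
by rewrite ger0_norm ?invr_ge0 ?(ltW nf)// mulrC.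
Qed.

Lemma opnorm_le T (M : R) : 0 <= M ->
  (forall f, rnorm (T f) <= M * rnorm f) -> opnorm T <= M%:C.
Proof.
move=> M0 TM; rewrite lecR; apply: ge_sup => // _ [f /= f1 <-].
rewrite (le_trans (TM f))// ler_piMr//.
by move: f1; rewrite rnormE lecR.
Qed.

Lemma opnormE T : opnorm T = (complex.Re (opnorm T))%:C. Proof. by []. Qed.

Lemma opnorm_ge0 T : 0 <= complex.Re (opnorm T).
Proof.
apply: (@le_trans _ _ (rnorm (T 0))); first exact: rnorm_ge0.
apply: ub_le_sup; last by exists 0 => //=; rewrite normr0 ler01.
have [M M0 TM] := bop_bound T.
exists M => _ [g /= g1 <-]; rewrite (le_trans (TM g))// ler_piMr//.
by move: g1; rewrite rnormE lecR.
Qed.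

Lemma rnorm_opnorm T f : rnorm (T f) <= complex.Re (opnorm T) * rnorm f.
Proof. by have := opnorm_ub T f; rewrite !rnormE opnormE -rmorphM lecR. Qed.

Lemma opnormD S T : opnorm (S + T) <= opnorm S + opnorm T.
Proof.
rewrite (opnormE S) (opnormE T) -rmorphD; apply: opnorm_le.
  by rewrite addr_ge0 ?opnorm_ge0.
move=> f; rewrite mulrDl (le_trans (rnormD _ _))//.
by rewrite lerD ?rnorm_opnorm.
Qed.

Let opnormZ_le (a : R[i]) T : opnorm (a *: T) <= `|a| * opnorm T.
Proof.
have aE : `|a| = (complex.Re `|a|)%:C by rewrite RRe_real// normr_real.
have a0 : 0 <= complex.Re `|a| by rewrite -lecR -aE normr_ge0.
rewrite (opnormE T) aE -rmorphM; apply: opnorm_le.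
  by rewrite mulr_ge0 ?opnorm_ge0.
move=> f; rewrite -lecR -rnormE bopZE normrZ aE -mulrA rmorphM ler_wpM2l//.
  by rewrite lecR.
by rewrite rnormE lecR rnorm_opnorm.
Qed.

Lemma opnormZ (a : R[i]) T : opnorm (a *: T) = `|a| * opnorm T.
Proof.
apply/eqP; rewrite eq_le opnormZ_le/=.
have [->|a0] := eqVneq a 0.
  by rewrite normr0 mul0r opnormE lecR opnorm_ge0.
rewrite -ler_pdivlMl ?normr_gt0//.
have := opnormZ_le a^-1 (a *: T).
by rewrite scalerA mulVf// scale1r normfV.
Qed.

Lemma opnorm0_eq0 T : opnorm T = 0 -> T = 0.
Proof.
move=> T0; apply: bopP => f; apply/normr0_eq0/eqP.
by rewrite eq_le normr_ge0 andbT (le_trans (opnorm_ub T f))// T0 mul0r.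
Qed.

HB.instance Definition _ := @Lmodule_isNormed.Build R[i] 'L(H) opnorm
  opnormD opnormZ opnorm0_eq0.

End BoundedOperatorTheory.

Section Riesz.
Context (R : realType) (H : hilbertType R).
Variables (phi : H -> R) (M : R).
Hypothesis phiD : forall f g, phi (f + g) = phi f + phi g.
Hypothesis phiZ : forall (r : R) f, phi (r%:C *: f) = r * phi f.
Hypothesis phi_bound : forall f, `|phi f| <= M * rnorm f.

Let F u := rnorm u ^+ 2 - 2 * phi u.
Let d := inf (range F).
Let A (e : R) := [set u | F u < d + e].

Let F_lb : has_inf (range F).
Proof.
split; first by exists (F 0), 0.
exists (- M ^+ 2) => _ [u _ <-].
have /ler_normlP[_] := phi_bound u; rewrite /F => h.
have := sqr_ge0 (rnorm u - M); lra.
Qed.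

Let d_le u : d <= F u.
Proof. by apply: ge_inf; [case: F_lb|exists u]. Qed.

Let A_neq0 e : 0 < e -> A e !=set0.
Proof.
move=> e0; have [_ [u _ <-] uE] := inf_adherent e0 F_lb.
by exists u.
Qed.

Let FF := filter_from [set e : R | 0 < e] A.

Let FF_proper : ProperFilter FF.
Proof.
apply: filter_from_proper => //; apply: filter_from_filter; first by exists 1 => /=.
move=> a b /= a0 b0; exists (Num.min a b) => /=; first by rewrite lt_min a0.
move=> u; rewrite /A /= => uab.
by split; rewrite (lt_le_trans uab)// lerD2l ge_min lexx ?orbT.
Qed.

Let parallelogram x y : rnorm (x - y) ^+ 2 =
  2 * F x + 2 * F y - 4 * F ((2^-1)%:C *: (x + y)).
Proof.
rewrite /F phiZ phiD -!rdotff !(rdotDl, rdotDr, rdotZl, rdotZr).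
rewrite (rdotC (- y)) !rdotNr (rdotC (- y)) !rdotNr (rdotC y x).
lra.
Qed.

Let FF_cauchy : cauchy FF.
Proof.
apply: (@cauchy_exP _ _ FF (@filter_filter _ _ FF_proper)) => e e0.
have eE : e = (complex.Re e)%:C by rewrite RRe_real// gtr0_real.
have re0 : 0 < complex.Re e by rewrite -ltcR -eE.
set r := complex.Re e in eE re0.
have r40 : 0 < r ^+ 2 / 4 by rewrite divr_gt0// exprn_gt0.
have [x Ax] := A_neq0 r40; exists x; exists (r ^+ 2 / 4) => // y Ay.
rewrite -ball_normE /ball_/= rnormE eE ltcR.
rewrite -(@ltr_pXn2r _ 2)// ?nnegrE ?rnorm_ge0// ?(ltW re0)//.
rewrite parallelogram; move: Ax Ay (d_le ((2^-1)%:C *: (x + y))).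
rewrite /A/=; lra.
Qed.

Lemma riesz_real : exists h, forall f, phi f = rdot f h.
Proof.
have /cvg_ex[h hE] := @cauchy_cvg _ FF FF_proper FF_cauchy.
exists h => f; apply/eqP; rewrite -subr_eq0 -normr_le0; apply/ler_addgt0Pl => e e0.
rewrite addr0.
set k := rnorm f ^+ 2 + 1.
have k1 : 1 <= k by rewrite lerDr sqr_ge0.
have k0 : 0 < k by lra.
have ek : 0 < (e / 2) ^+ 2 / k by rewrite divr_gt0// exprn_gt0// divr_gt0.
have ef : 0 < e / 2 / (rnorm f + 1).
  by rewrite divr_gt0 ?divr_gt0// ltr_wpDl ?rnorm_ge0.
have : FF (A ((e / 2) ^+ 2 / k) `&` ball h (e / 2 / (rnorm f + 1))%:C).
  apply: (@filterI _ _ (@filter_filter _ _ FF_proper)); first by exists ((e / 2) ^+ 2 / k).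
  by apply: hE; apply: nbhsx_ballx; rewrite ltcR.
move=> /(@filter_ex _ FF FF_proper)[u [uA]]; rewrite -ball_normE /ball_/= rnormE ltcR => hu.
have -> : phi f - rdot f h = (phi f - rdot f u) - rdot f (h - u).
  by rewrite rdotDr rdotNr; ring.
rewrite (le_trans (ler_normB _ _))// [leRHS]splitr lerD//; last first.
  rewrite (le_trans (rdot_CS _ _))//.
  move: hu; rewrite ltr_pdivlMr ?ltr_wpDl ?rnorm_ge0// => /ltW; apply: le_trans.
  rewrite mulrC ler_wpM2l ?rnorm_ge0//; lra.
set c := phi f - rdot f u.
have := d_le (u + (c / k)%:C *: f).
rewrite /F phiD phiZ -rdotff !(rdotDl, rdotDr, rdotZl, rdotZr) (rdotC u f) !rdotff.
move: uA; rewrite /A /F/= => uA h1.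
have {}h1 : 2 * (c / k) * c - (c / k) ^+ 2 * rnorm f ^+ 2 <= (e / 2) ^+ 2 / k.
  by move: (c / k) h1 => t h1; rewrite /c; lra.
rewrite -(@ler_pXn2r _ 2)// ?nnegrE// ?(ltW e0)//; last by rewrite divr_ge0 ?ltW.
rewrite real_normK ?num_real//.
rewrite -(@ler_pM2r _ k^-1) ?invr_gt0//.
apply: le_trans h1.
have -> : rnorm f ^+ 2 = k - 1 by rewrite /k; ring.
rewrite -subr_ge0.
have -> : 2 * (c / k) * c - (c / k) ^+ 2 * (k - 1) - c ^+ 2 / k = (c / k) ^+ 2.
  by field; rewrite gt_eqF.
exact: sqr_ge0.
Qed.

End Riesz.

Section Adjoint.
Context (R : realType) (H : hilbertType R).
Implicit Types (S T U : 'L(H)) (f g h : H).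

(* get picks an element of a nonempty set; see adjointP, which follows from the
   Riesz representation theorem. *)
Definition adjoint T : 'L(H) :=
  get [set S : 'L(H) | forall f g, hdot (T f) g = hdot f (S g)].

Lemma rdot_hdot f g f' g' :
  (forall a : R[i], rdot (a *: f) g = rdot (a *: f') g') -> hdot f g = hdot f' g'.
Proof.
move=> fg; have := fg 1; have := fg 'i%C.
rewrite !scale1r /rdot !hdotZl; case: (hdot f g : R[i]) => a b.
case: (hdot f' g' : R[i]) => a' b' /=.
by rewrite !mul0r !mul1r !sub0r => /oppr_inj -> ->.
Qed.

Lemma hdot_inj g g' : (forall f, hdot f g = hdot f g') -> g = g'.
Proof.
move=> gg'; apply/eqP; rewrite -subr_eq0; apply/eqP/rnorm_eq0/eqP.
rewrite -sqrf_eq0 -rdotff rdotDr rdotNr /rdot gg' -/(rdot _ _).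
by rewrite subrr.
Qed.

Lemma adjoint_exists T :
  exists S : 'L(H), forall f g, hdot (T f) g = hdot f (S g).
Proof.
have [M M0 TM] := bop_bound T.
have /choice[S ST] : forall g, exists h, forall f, rdot (T f) g = rdot f h.
  move=> g; apply: (@riesz_real _ _ (fun f => rdot (T f) g) (M * rnorm g)).
  - by move=> f f'; rewrite raddfD rdotDl.
  - by move=> r f; rewrite linearZ_LR rdotZl.
  - move=> f; rewrite (le_trans (rdot_CS _ _))// mulrAC.
    by rewrite ler_wpM2r ?rnorm_ge0.
have {}ST f g : hdot (T f) g = hdot f (S g).
  by apply: rdot_hdot => a; rewrite -ST linearZ_LR.
have SP : S \in bounded_operator H.
  apply/mem_set; split=> [a f g|].
    by apply: hdot_inj => h; rewrite -ST !hdotDr !hdotZr !ST.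
  exists M%:C => g; rewrite !rnormE -rmorphM lecR.
  have [->|Sg0] := eqVneq (rnorm (S g)) 0; first by rewrite mulr_ge0 ?rnorm_ge0.
  have Sg : 0 < rnorm (S g) by rewrite lt_neqAle eq_sym Sg0 rnorm_ge0.
  rewrite -(ler_pM2l Sg) -expr2 -rdotff /rdot -ST -/(rdot _ _).
  rewrite (le_trans (ler_norm _))// (le_trans (rdot_CS _ _))//.
  by rewrite mulrA [_ * M]mulrC ler_wpM2r ?rnorm_ge0.
by exists (BOp SP).
Qed.

Lemma adjointP T f g : hdot (T f) g = hdot f (adjoint T g).
Proof. by move: f g; have /getPex := adjoint_exists T. Qed.

Lemma adjoint_eq T S : (forall f g, hdot (T f) g = hdot f (S g)) -> adjoint T = S.
Proof. by move=> TS; apply: bopP => g; apply: hdot_inj => f; rewrite -adjointP TS. Qed.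

Lemma adjointK T : adjoint (adjoint T) = T.
Proof.
by apply: adjoint_eq => f g; rewrite hdotC -adjointP -hdotC.
Qed.

Lemma adjointM S T : adjoint (S * T) = adjoint T * adjoint S.
Proof. by apply: adjoint_eq => f g; rewrite !bopME -!adjointP. Qed.

Lemma adjoint1 : adjoint 1 = 1.
Proof. exact: adjoint_eq. Qed.

End Adjoint.

(* J = J^* = J^-1 *)
Record symmetry (R : realType) (H : hilbertType R) := Symmetry {
  symmetry_op :> 'L(H) ;
  symmetry_adjoint : adjoint symmetry_op = symmetry_op ;
  symmetry_square : symmetry_op * symmetry_op = 1
}.

Lemma conj_eq_comm (A : pzRingType) (u u' v v' q : A) :
  u' * u = 1 -> v' * v = 1 -> u * q * u' = v * q * v' ->
  u' * v * q = q * (u' * v).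
Proof.
move=> u'u v'v /(congr1 (fun x => u' * x * v)).
by rewrite !mulrA u'u mul1r => ->; rewrite -[RHS]mulrA v'v mulr1.
Qed.

Section Krein.
Context (R : realType) (H : hilbertType R) (J : symmetry H).
Local Notation j := (symmetry_op J).
Implicit Types (S T U V Q : 'L(H)).

Definition kdot (f g : H) : R[i] := hdot (j f) g.

Definition Jadjoint T : 'L(H) := j * adjoint T * j.

Lemma JadjointP T f g : kdot (T f) g = kdot f (Jadjoint T g).
Proof.
have jP u v : hdot (j u) v = hdot u (j v).
  by rewrite adjointP symmetry_adjoint.
rewrite /kdot jP adjointP /Jadjoint !bopME -jP; congr (hdot _ _).
by rewrite -bopME symmetry_square.
Qed.

Definition Jnormal_projection : set 'L(H) :=
  [set Q | Q * Q = Q /\ Q * Jadjoint Q = Jadjoint Q * Q].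

Definition Junitary : set 'L(H) :=
  [set U | U * Jadjoint U = 1 /\ Jadjoint U * U = 1].

Lemma JadjointM S T : Jadjoint (S * T) = Jadjoint T * Jadjoint S.
Proof.
by rewrite /Jadjoint adjointM !mulrA -(mulrA _ j j) symmetry_square mulr1.
Qed.

Lemma JadjointK T : Jadjoint (Jadjoint T) = T.
Proof.
rewrite /Jadjoint !adjointM adjointK symmetry_adjoint !mulrA symmetry_square.
by rewrite mul1r -mulrA symmetry_square mulr1.
Qed.

Lemma Jadjoint1 : Jadjoint 1 = 1.
Proof. by rewrite /Jadjoint adjoint1 mulr1 symmetry_square. Qed.

Lemma Junitary1 : Junitary 1.
Proof. by rewrite /Junitary /= Jadjoint1 mulr1. Qed.

Lemma JunitaryV U : Junitary U -> Junitary (Jadjoint U).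
Proof. by move=> [UV VU]; split; rewrite JadjointK. Qed.

Lemma JunitaryM U V : Junitary U -> Junitary V -> Junitary (U * V).
Proof.
move=> [U1 U2] [V1 V2]; split; rewrite JadjointM.
  by rewrite mulrA -(mulrA U) V1 mulr1.
by rewrite mulrA -(mulrA _ _ U) U2 mulr1.
Qed.

Definition Jconjugate Q U : 'L(H) := U * Q * Jadjoint U.

(* Used as types, Junitary and Jorbit Q carry the topology induced by the
   operator norm of 'L(H). *)
Definition Jorbit Q : set 'L(H) := [set Jconjugate Q U | U in Junitary].

Definition Jorbit_map Q (U : Junitary) : Jorbit Q :=
  SigSub (mem_set (ex_intro2 _ _ (set_val U) (set_valP U) erefl)).

Definition Jisotropy Q : set 'L(H) := [set U | Junitary U /\ U * Q = Q * U].

(* V \in U G, where G is the isotropy group of Q. *)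
Definition same_Jcoset Q (U V : Junitary) : bool :=
  `[< exists2 W, Jisotropy Q W & set_val V = set_val U * W >].

Lemma Jisotropy1 Q : Jisotropy Q 1.
Proof. by split; [exact: Junitary1|rewrite mul1r mulr1]. Qed.

Lemma JisotropyV Q U : Jisotropy Q U -> Jisotropy Q (Jadjoint U).
Proof.
move=> [uU UQ]; split; first exact: JunitaryV.
case: uU => UV VU; rewrite -[LHS]mulr1 -UV !mulrA -(mulrA _ Q) -UQ.
by rewrite !mulrA VU mul1r.
Qed.

Lemma JisotropyM Q U V : Jisotropy Q U -> Jisotropy Q V -> Jisotropy Q (U * V).
Proof.
move=> [uU UQ] [uV VQ]; split; first exact: JunitaryM.
by rewrite -mulrA VQ mulrA UQ mulrA.
Qed.

Lemma same_Jcoset_refl Q : reflexive (same_Jcoset Q).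
Proof. by move=> U; apply/asboolP; exists 1; rewrite ?mulr1//; exact: Jisotropy1. Qed.

Lemma same_Jcoset_sym Q : symmetric (same_Jcoset Q).
Proof.
suff h (U V : Junitary) : same_Jcoset Q U V -> same_Jcoset Q V U.
  by move=> U V; apply/idP/idP; exact: h.
move=> /asboolP[W gW VE]; apply/asboolP; exists (Jadjoint W).
  exact: JisotropyV.
by rewrite VE -mulrA gW.1.1 mulr1.
Qed.

Lemma same_Jcoset_trans Q : transitive (same_Jcoset Q).
Proof.
move=> V U W /asboolP[X gX VE] /asboolP[Y gY WE]; apply/asboolP; exists (X * Y).
  exact: JisotropyM.
by rewrite WE VE mulrA.
Qed.

Canonical same_Jcoset_equiv Q := EquivRel (same_Jcoset Q)
  (same_Jcoset_refl Q) (same_Jcoset_sym Q) (@same_Jcoset_trans Q).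

Definition Jcoset_space Q := quotient_topology {eq_quot (same_Jcoset_equiv Q)}.

Lemma same_JcosetP Q (U V : Junitary) :
  reflect (Jorbit_map Q U = Jorbit_map Q V) (same_Jcoset Q U V).
Proof.
have uU := set_valP U; have uV := set_valP V.
apply: (iffP idP) => [/asboolP[W [uW WQ] VE]|/(congr1 set_val) /= UV].
  apply: val_inj => /=; rewrite /Jconjugate VE JadjointM.
  case: uW; move: (Jadjoint W) (Jadjoint (set_val U)) => W' U' WW' _.
  by rewrite !mulrA -(mulrA _ W) WQ !mulrA -(mulrA _ W) WW' mulr1.
apply/asboolP; exists (Jadjoint (set_val U) * set_val V); last first.
  by rewrite mulrA uU.1 mul1r.
split; first by apply: JunitaryM; [exact: JunitaryV|].
exact: conj_eq_comm uU.2 uV.2 UV.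
Qed.

Definition Jcoset_orbit Q (x : Jcoset_space Q) : Jorbit Q := Jorbit_map Q (repr x).

Lemma Jcoset_orbit_pi Q (U : Junitary) :
  Jcoset_orbit (\pi_(Jcoset_space Q) U : Jcoset_space Q) = Jorbit_map Q U.
Proof. by apply/same_JcosetP/eqmodP; rewrite reprK. Qed.

Lemma Jcoset_orbit_bij Q : bijective (@Jcoset_orbit Q).
Proof.
rewrite -setTT_bijective; split=> // [x y _ _ /same_JcosetP/eqmodP|[T TQ] _].
  by rewrite !reprK.
have [U uU UE] := set_mem TQ.
exists (\pi_(Jcoset_space Q) (SigSub (mem_set uU) : Junitary)) => //.
by rewrite Jcoset_orbit_pi; exact: val_inj.
Qed.

(* The open sets of the topology of the quotient of the J-unitary group by the
   isotropy group, transported to the orbit by the bijection Jcoset_orbit. *)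
Definition Jorbit_quotient_open Q (W : set (Jorbit Q)) : Prop :=
  open (@Jcoset_orbit Q @^-1` W).

End Krein.
Arguments Jorbit {R H} J Q.
Arguments Jorbit_map {R H} J Q U.
Arguments Jisotropy {R H} J Q.
Arguments same_Jcoset {R H} J Q U V.
Arguments Jcoset_space {R H} J Q.
Arguments Jcoset_orbit {R H} J Q x.
Arguments Jorbit_quotient_open {R H} J Q W.

(* Main.v *)
Require Import Defs.
From mathcomp Require Import all_boot all_order all_algebra.
From mathcomp Require Import all_classical all_reals all_analysis.
From mathcomp Require Import complex lra.

(** Fix a J-normal projection P.  Since P commutes with its J-adjoint P#, the
products of P or 1 - P with P# or 1 - P# are four idempotents that annihilate
each other and sum to 1.  For another J-normal projection Q, multiply each of
the four idempotents of Q by the corresponding one of P and let S be the sum: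
S intertwines P with Q and P# with Q#, depends continuously on Q, and is 1 when
Q = P ([block_intertwinerP], [block_intertwiner_id]).  So S is close to 1 when Q
is close to P, but it need not be J-unitary.

The cure is a polar decomposition for the J-adjoint: divide S by the square root
of S# S.  If A is close to 1, exactly one B close to 1 satisfies B A B = 1; it
depends continuously on A, commutes with whatever commutes with A, and is
J-selfadjoint if A is ([inverse_sqrt_exists], [inverse_sqrt_lipschitz],
[inverse_sqrt_comm], [inverse_sqrt_Jselfadjoint]).  Here S# S commutes with P,
because S moves P to Q and S# moves Q back to P; hence so does B, and U = S B is
a J-unitary operator with U P U# = Q ([Junitary_polar]).

Taking for P a point V Q0 V# of the orbit, the map that sends Q to U V is a
continuous section near P ([Jorbit_map_sections]).  A continuous map with local
continuous sections is a quotient map ([open_quotient_of_sections]), which gives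
the comparison of the two topologies of the orbit. *)

Set Implicit Arguments.
Unset Strict Implicit.
Unset Printing Implicit Defensive.

Import Order.TTheory GRing.Theory Num.Theory.
Import numFieldNormedType.Exports.

Local Open Scope classical_set_scope.
Local Open Scope complex_scope.
Local Open Scope ring_scope.

(** * The operator norm and completeness *)

Section OperatorNorm.
Context (R : realType) (H : hilbertType R).
Implicit Types (S T A : 'L(H)) (f g : H).

(** The norm of the normed module is valued in R[i]; estimates are carried out with
its real part. *)
Definition bnorm T : R := complex.Re (opnorm T).

Lemma normr_bnorm T : `|T| = (bnorm T)%:C.
Proof. by []. Qed.

Lemma bnorm_ge0 T : 0 <= bnorm T. Proof. exact: opnorm_ge0. Qed.

Lemma rnorm_bnorm T f : rnorm (T f) <= bnorm T * rnorm f.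
Proof. exact: rnorm_opnorm. Qed.

Lemma bnorm_le T (M : R) : 0 <= M ->
  (forall f, rnorm (T f) <= M * rnorm f) -> bnorm T <= M.
Proof. by move=> M0 TM; rewrite -lecR -normr_bnorm; exact: opnorm_le. Qed.

Lemma bnormD S T : bnorm (S + T) <= bnorm S + bnorm T.
Proof. by rewrite -lecR rmorphD/= -!normr_bnorm ler_normD. Qed.

Lemma bnormN T : bnorm (- T) = bnorm T.
Proof. by apply: complexI; rewrite -!normr_bnorm normrN. Qed.

Lemma bnormB S T : bnorm (S - T) <= bnorm S + bnorm T.
Proof. by rewrite (le_trans (bnormD _ _))// bnormN. Qed.

Lemma bnorm_distC S T : bnorm (S - T) = bnorm (T - S).
Proof. by rewrite -bnormN opprB. Qed.

Lemma bnorm_distD T S A : bnorm (S - A) <= bnorm (S - T) + bnorm (T - A).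
Proof. by rewrite -[S - A](subrKA T) bnormD. Qed.

Lemma bnorm0 : bnorm 0 = 0.
Proof. by apply: complexI; rewrite -normr_bnorm normr0. Qed.

Lemma bnorm_eq0 T : bnorm T <= 0 -> T = 0.
Proof. by move=> T0; apply/normr0_eq0/eqP; rewrite eq_le normr_ge0 normr_bnorm lecR T0. Qed.

Lemma bnorm_double T : bnorm (T + T) = bnorm T + bnorm T.
Proof. by apply: complexI; rewrite rmorphD/= -!normr_bnorm -mulr2n normrMn mulr2n. Qed.

Lemma bnormM S T : bnorm (S * T) <= bnorm S * bnorm T.
Proof.
apply: bnorm_le => [|f]; first by rewrite mulr_ge0 ?bnorm_ge0.
by rewrite bopME (le_trans (rnorm_bnorm _ _))// -mulrA ler_wpM2l ?bnorm_ge0 ?rnorm_bnorm.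
Qed.

Lemma bnorm1_le1 : bnorm 1 <= 1.
Proof. by apply: bnorm_le => // f; rewrite mul1r. Qed.

Lemma cvg_bnormP (X : Type) (F : set_system X) {FF : Filter F} (u : X -> 'L(H)) T :
  u @ F --> T <-> forall e : R, 0 < e -> \forall x \near F, bnorm (T - u x) < e.
Proof.
split=> [/cvgrPdist_lt uT e e0|uT].
  have := uT e%:C; rewrite ltcR => /(_ e0); apply: filterS => x.
  by rewrite normr_bnorm ltcR.
apply/cvgrPdist_lt => e e0.
have eE : e = (complex.Re e)%:C by rewrite RRe_real// gtr0_real.
have re0 : 0 < complex.Re e by rewrite -ltcR -eE.
have := uT _ re0; apply: filterS => x.
by rewrite eE normr_bnorm ltcR.
Qed.

(** Pointwise limits exist by completeness of H.  Being close in F is uniform over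
the unit ball, which makes the limit bounded and the convergence a convergence
in norm. *)
Lemma bop_complete (F : set_system 'L(H)) : ProperFilter F -> cauchy F ->
  exists T, F --> T.
Proof.
move=> FF /cauchy_ballP Fc.
have {}Fc e : 0 < e -> exists A B : set 'L(H), [/\ F A, F B &
    forall S T, A S -> B T -> bnorm (S - T) < e].
  move=> e0; have := Fc e%:C; rewrite ltcR => /(_ e0)[[A B] [/= FA FB] AB].
  exists A, B; split=> // S T AS BT; have /= := AB (S, T) (conj AS BT).
  by rewrite -ball_normE /ball_/= normr_bnorm ltcR.
have /choice[L FL] : forall f, exists g, (fun T => T f) @ F --> g.
  move=> f; suff : cauchy ((fun T : 'L(H) => T f) @ F).
    by move=> /cauchy_cvg/cvg_ex.
  apply/cauchy_ballP => e e0.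
  have eE : e = (complex.Re e)%:C by rewrite RRe_real// gtr0_real.
  have re0 : 0 < complex.Re e by rewrite -ltcR -eE.
  have f1 : 0 < rnorm f + 1 by rewrite ltr_wpDl ?rnorm_ge0.
  have [A [B [FA FB AB]]] := Fc _ (divr_gt0 re0 f1).
  exists ((fun T => T f) @` A, (fun T => T f) @` B).
    by split; rewrite nbhs_simpl/=; [move: FA|move: FB];
      apply: filterS => T ? /=; exists T.
  move=> [_ _] /= [[S AS <-] [T BT <-]].
  rewrite -ball_normE /ball_/= eE rnormE ltcR.
  rewrite -[_ - _]/((S - T) f) (le_lt_trans (rnorm_bnorm _ _))//.
  have := AB S T AS BT; rewrite ltr_pdivlMr// => h.
  rewrite (le_lt_trans _ h)// ler_wpM2l ?bnorm_ge0//; lra.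
have Llin : linear L.
  move=> a f g; apply: (@cvg_unique _ (@norm_hausdorff _ H) _ _ _ _ (FL _)).
  rewrite (_ : (fun T : 'L(H) => _) = (fun T => a *: T f + T g)); last first.
    by apply/funext => T; rewrite linearP.
  by apply: cvgD (FL g); exact: cvgZr (FL f).
(* Insert T f with T close to S in norm and T f close to L f: the latter
   closeness depends on f, but T disappears from the bound. *)
have LA e (A B : set 'L(H)) S : 0 < e -> F B -> A S ->
    (forall S T, A S -> B T -> bnorm (S - T) < e) ->
    forall f, rnorm (S f - L f) <= e * rnorm f.
  move=> e0 FB AS AB f; apply/ler_addgt0Pr => d d0.
  have FLf : \forall T \near F, `|L f - (T : 'L(H)) f| < d%:C.
    by apply: cvgr_dist_lt; [exact: FL|rewrite ltcR].
  have [T [BT LT]] := @filter_ex _ _ FF _ (filterI FB FLf).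
  rewrite -[_ - _](subrKA (T f)) (le_trans (rnormD _ _))// lerD//.
    rewrite -[_ - _]/((S - T) f) (le_trans (rnorm_bnorm _ _))//.
    by rewrite ler_wpM2r ?rnorm_ge0// ltW// AB.
  by move: LT; rewrite -normrN opprB rnormE ltcR => /ltW.
have Lbd : L \in bounded_operator H.
  apply/mem_set; split=> //.
  have [A [B [FA FB AB]]] := Fc 1 ltr01.
  have [S AS] := @filter_ex _ _ FF _ FA.
  exists (1 + bnorm S)%:C => f; rewrite !rnormE -rmorphM lecR/= mulrDl.
  have -> : L f = - (S f - L f) + S f by rewrite opprB subrK.
  rewrite (le_trans (rnormD _ _))// lerD ?rnorm_bnorm//.
  have := LA 1 A B S ltr01 FB AS AB f.
  by rewrite -!lecR -!rnormE normrN.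
exists (BOp Lbd); apply/cvg_bnormP => e e0.
have e20 : 0 < e / 2 by lra.
have [A [B [FA FB AB]]] := Fc _ e20.
apply: filterS FA => S AS; rewrite bnorm_distC.
apply: (@le_lt_trans _ _ (e / 2)); last lra.
by apply: bnorm_le; [exact: ltW|move=> f; exact: (LA _ A B)].
Qed.

(** The form in which completeness serves fixed point iterations. *)
Lemma geometric_cvg (u : nat -> 'L(H)) :
  (forall n, bnorm (u n.+1 - u n) <= (2^-1) ^+ n) -> exists T, u @ \oo --> T.
Proof.
move=> uS.
have uD n m : bnorm (u n - u (n + m)%N) <= 2 * 2^-1 ^+ n - 2 * 2^-1 ^+ (n + m).
  elim: m => [|m IH]; first by rewrite addn0 !subrr bnorm0.
  rewrite (le_trans (bnorm_distD (u (n + m)%N) _ _))// addnS.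
  have := uS (n + m)%N; rewrite bnorm_distC exprS.
  by move: IH; set x := bnorm _; set y := bnorm _; lra.
apply: bop_complete.
apply: cauchy_exP => e e0.
have eE : e = (complex.Re e)%:C by rewrite RRe_real// gtr0_real.
have re0 : 0 < complex.Re e / 2 by rewrite divr_gt0// -ltcR -eE.
have [N _ NP] := near_infty_natSinv_expn_lt (PosNum re0).
exists (u N), N => // m /= Nm.
rewrite -ball_normE /ball_/= normr_bnorm eE ltcR.
rewrite -(subnKC Nm) (le_lt_trans (uD _ _))//.
have /= := NP N (leqnn N).
have : 0 <= (2^-1 : R) ^+ (N + (m - N)) by rewrite exprn_ge0// invr_ge0.
rewrite div1r -exprVn; set x := _ ^+ _; set y := _ ^+ _; lra.
Qed.

Lemma cvg_bopM (X : Type) (F : set_system X) {FF : Filter F} (u v : X -> 'L(H)) S T :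
  u @ F --> S -> v @ F --> T -> (fun x => u x * v x) @ F --> S * T.
Proof.
move=> /cvg_bnormP uS /cvg_bnormP vT; apply/cvg_bnormP => e e0.
set a := bnorm S + 1; set b := bnorm T + 1.
have a0 : 0 < a by rewrite ltr_wpDl ?bnorm_ge0.
have b0 : 0 < b by rewrite ltr_wpDl ?bnorm_ge0.
have d0 : 0 < Num.min 1 (e / 2 / b) by rewrite lt_min ltr01 !divr_gt0.
have d'0 : 0 < e / 2 / a by rewrite !divr_gt0.
apply: filterS (filterI (uS _ d0) (vT _ d'0)) => x [].
rewrite lt_min => /andP[u1 ub] vb.
have -> : S * T - u x * v x = (S - u x) * T + u x * (T - v x).
  by rewrite mulrBl mulrBr subrKA.
rewrite (le_lt_trans (bnormD _ _))//.
move: ub vb; rewrite !ltr_pdivlMr// => ub vb.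
have h1 := bnormM (S - u x) T; have h2 := bnormM (u x) (T - v x).
have h3 : bnorm (u x) <= a.
  rewrite -[u x](subKr S) (le_trans (bnormB _ _))// lerD2l ltW//.
have h4 : bnorm (u x) * bnorm (T - v x) <= bnorm (T - v x) * a.
  by rewrite mulrC ler_wpM2l ?bnorm_ge0.
have h5 : bnorm (S - u x) * bnorm T <= bnorm (S - u x) * b.
  by rewrite ler_wpM2l ?bnorm_ge0// lerDl.
lra.
Qed.

Lemma continuous_bopM (X : topologicalType) (u v : X -> 'L(H)) :
  continuous u -> continuous v -> continuous (fun x => u x * v x).
Proof. by move=> uc vc x; apply: cvg_bopM; [exact: uc|exact: vc]. Qed.

End OperatorNorm.

(** * Inverse square roots near the identity *)

Section InverseSquareRoot.
Context (R : realType) (H : hilbertType R).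
Implicit Types (S T A B D X Y Z : 'L(H)).

Lemma bnorm_near1 B (b : R) : bnorm (B - 1) <= b -> bnorm B <= b + 1.
Proof.
move=> Bb; rewrite -[B](subrK 1) (le_trans (bnormD _ _))// lerD//.
exact: bnorm1_le1.
Qed.

Lemma bnorm_1sub_le A B (a b : R) : bnorm (A - 1) <= a -> bnorm (B - 1) <= b ->
  bnorm (1 - A * B) <= a * (b + 1) + b.
Proof.
move=> Aa Bb; rewrite bnorm_distC.
have -> : A * B - 1 = (A - 1) * B + (B - 1) by rewrite mulrBl mul1r subrKA.
rewrite (le_trans (bnormD _ _))// lerD// (le_trans (bnormM _ _))//.
by rewrite ler_pM ?bnorm_ge0// bnorm_near1.
Qed.

(** With B * A * B = 1 instead of B ^+ 2 * A = 1, (S B)# (S B) = 1 is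
immediate for A = S# S and B# = B, whether or not A and B commute.  The closeness of B to 1 selects one solution
among others such as - B, and the radii 1/4 for B and 1/16 for A are small
enough for all the estimates below. *)
Definition inverse_sqrt A B : Prop := bnorm (B - 1) <= 4^-1 /\ B * A * B = 1.

Lemma inverse_sqrt_half A B : bnorm (A - 1) <= 16^-1 -> bnorm (B - 1) <= 4^-1 ->
  bnorm (1 - B * A) <= 2^-1 /\ bnorm (1 - A * B) <= 2^-1.
Proof.
move=> A1 B1; split.
  by rewrite (le_trans (bnorm_1sub_le B1 A1))//; lra.
by rewrite (le_trans (bnorm_1sub_le A1 B1))//; lra.
Qed.

(** For X and Y close to 1, D |-> X D + D Y is close to doubling.  The derivative
of B |-> B A B has this form, which is why this single estimate gives both the
contraction and the commutation property. *)
Lemma sylvester_bound D X Y : bnorm (1 - X) <= 2^-1 -> bnorm (1 - Y) <= 2^-1 ->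
  bnorm (D + D - (X * D + D * Y)) <= bnorm D.
Proof.
move=> X1 Y1.
have -> : D + D - (X * D + D * Y) = (1 - X) * D + D * (1 - Y).
  by rewrite mulrBl mulrBr mul1r mulr1 [RHS]addrACA -opprD.
rewrite (le_trans (bnormD _ _))//.
have XD : bnorm ((1 - X) * D) <= 2^-1 * bnorm D.
  by rewrite (le_trans (bnormM _ _))// ler_wpM2r ?bnorm_ge0.
have DY : bnorm (D * (1 - Y)) <= bnorm D * 2^-1.
  by rewrite (le_trans (bnormM _ _))// ler_wpM2l ?bnorm_ge0.
lra.
Qed.

Lemma sylvester_inj D X Y : bnorm (1 - X) <= 2^-1 -> bnorm (1 - Y) <= 2^-1 ->
  X * D + D * Y = 0 -> D = 0.
Proof.
move=> X1 Y1 XDY; have := sylvester_bound D X1 Y1.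
have := bnorm_ge0 D.
by rewrite XDY subr0 bnorm_double => ? ?; apply: bnorm_eq0; lra.
Qed.

Lemma sandwich_contraction A B B' : bnorm (A - 1) <= 16^-1 ->
  bnorm (B - 1) <= 4^-1 -> bnorm (B' - 1) <= 4^-1 ->
  bnorm ((B - B') + (B - B') - (B * A * B - B' * A * B')) <= bnorm (B - B').
Proof.
move=> A1 B1 B'1.
have [BA _] := inverse_sqrt_half A1 B1; have [_ AB'] := inverse_sqrt_half A1 B'1.
have -> : B * A * B - B' * A * B' = B * A * (B - B') + (B - B') * (A * B').
  by rewrite mulrBr mulrBl !mulrA subrKA.
exact: sylvester_bound.
Qed.

(** Solve B A B = 1 by the iteration B |-> B - (B A B - 1) / 2, a contraction
because the derivative of B A B is about 2 near 1. *)
Lemma inverse_sqrt_exists A : bnorm (A - 1) <= 16^-1 -> exists B, inverse_sqrt A B.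
Proof.
move=> A1.
pose half X : 'L(H) := (2^-1 : R[i]) *: X.
have halfD X : half X + half X = X.
  by rewrite -mulr2n -scaler_nat scalerA mulfV ?scale1r// pnatr_eq0.
have half_norm X : bnorm (half X) = bnorm X / 2.
  by have := bnorm_double (half X); rewrite halfD; lra.
pose step B := B - half (B * A * B - 1).
have stepD B : step B + step B = B + B - (B * A * B - 1).
  by rewrite addrACA -opprD halfD.
have step_lip B B' : bnorm (B - 1) <= 4^-1 -> bnorm (B' - 1) <= 4^-1 ->
    bnorm (step B - step B') <= bnorm (B - B') / 2.
  move=> B1 B'1; have := sandwich_contraction A1 B1 B'1.
  have -> : B - B' + (B - B') - (B * A * B - B' * A * B') =
      (step B - step B') + (step B - step B').
    rewrite (addrACA (step B)) -(opprD (step B')) !stepD (addrACA B) -(opprD B').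
    rewrite (opprD (B' + B')) (addrACA (B + B)) -(opprD (B * A * B - 1)).
    by rewrite (opprB _ 1) subrKA.
  by rewrite bnorm_double; lra.
have step1 : bnorm (step 1 - 1) <= 32^-1.
  by rewrite /step mul1r mulr1 addrC addKr bnormN half_norm; lra.
have step_ball B : bnorm (B - 1) <= 4^-1 -> bnorm (step B - 1) <= 4^-1.
  move=> B1; rewrite (le_trans (bnorm_distD (step 1) _ _))//.
  by have := step_lip B 1 B1; rewrite subrr bnorm0; lra.
pose u n := iter n step 1.
have u1 n : bnorm (u n - 1) <= 4^-1.
  by elim: n => [|n /step_ball//]; rewrite subrr bnorm0; lra.
have uS n : bnorm (u n.+1 - u n) <= 2^-1 ^+ n.
  elim: n => [|n IH]; first by rewrite expr0 /=; lra.
  by apply: le_trans (step_lip (u n.+1) (u n) (u1 _) (u1 _)) _; rewrite exprS; lra.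
have [B uB] := geometric_cvg uS.
exists B; split.
  apply/ler_addgt0Pr => e e0.
  have /cvg_bnormP/(_ _ e0)/filter_ex[n un] := uB.
  by rewrite (le_trans (bnorm_distD (u n) _ _))// addrC lerD// ltW.
have uBS : (fun n => u n.+1) @ \oo --> B by rewrite -cvg_shiftS in uB.
have uAu : (fun n => u n * A * u n) @ \oo --> B * A * B.
  by apply: cvg_bopM => //; apply: cvg_bopM => //; exact: cvg_cst.
apply: (cvg_unique (@norm_hausdorff _ 'L(H)) uAu).
have -> : (fun n => u n * A * u n) = (fun n => u n + u n - (u n.+1 + u n.+1) + 1).
  by apply/funext => n; rewrite /= stepD subKr subrK.
suff : (fun n => u n + u n - (u n.+1 + u n.+1) + 1) @ \oo --> B + B - (B + B) + 1.
  by rewrite subrr add0r.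
by apply: cvgD; [apply: cvgB; exact: cvgD|exact: cvg_cst].
Qed.

(** The contraction estimate bounds the distance of B and B' by that of B A B and
B' A B'; the former is 1 = B' A' B', so only A - A' is left. *)
Lemma inverse_sqrt_lipschitz A A' B B' :
  bnorm (A - 1) <= 16^-1 -> bnorm (A' - 1) <= 16^-1 ->
  inverse_sqrt A B -> inverse_sqrt A' B' ->
  bnorm (B - B') <= 2 * bnorm (A - A').
Proof.
move=> A1 A'1 [B1 BAB] [B'1 B'A'B'].
set D := B - B'.
have h1 := sandwich_contraction A1 B1 B'1; rewrite -/D in h1.
have h2 : B * A * B - B' * A * B' = B' * (A' - A) * B'.
  by rewrite BAB -B'A'B' mulrBr mulrBl.
have h3 : bnorm (B' * (A' - A) * B') <= (5 / 4) ^+ 2 * bnorm (A - A').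
  have B'5 : bnorm B' <= 5 / 4.
    by rewrite (le_trans (bnorm_near1 B'1))//; lra.
  rewrite (le_trans (bnormM _ _))// (bnorm_distC A) expr2 mulrAC.
  by rewrite ler_pM ?bnorm_ge0// (le_trans (bnormM _ _))// ler_wpM2r ?bnorm_ge0.
have := bnorm_ge0 (A - A').
have : bnorm (D + D) <= bnorm D + bnorm (B' * (A' - A) * B').
  rewrite -(subrK (B' * (A' - A) * B') (D + D)) (le_trans (bnormD _ _))//.
  by rewrite lerD2r -h2.
by rewrite bnorm_double; lra.
Qed.

Lemma continuous_inverse_sqrt (X : topologicalType) (a b : X -> 'L(H)) :
  (forall x, bnorm (a x - 1) <= 16^-1) -> (forall x, inverse_sqrt (a x) (b x)) ->
  continuous a -> continuous b.
Proof.
move=> a1 ab ac x; apply/cvg_bnormP => e e0.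
have /cvg_bnormP/(_ (e / 2)) := ac x.
rewrite divr_gt0// => /(_ isT); apply: filterS => y axy.
apply: le_lt_trans (inverse_sqrt_lipschitz (a1 x) (a1 y) (ab x) (ab y)) _.
lra.
Qed.

Lemma inverse_sqrt_unique A B B' : bnorm (A - 1) <= 16^-1 ->
  inverse_sqrt A B -> inverse_sqrt A B' -> B = B'.
Proof.
move=> A1 AB AB'; apply/subr0_eq/bnorm_eq0.
by rewrite (le_trans (inverse_sqrt_lipschitz A1 A1 AB AB'))// subrr bnorm0 mulr0.
Qed.

(** Z commutes with 1 = B A B; moving Z through the three factors one at a time
produces a commutator with B at each end. *)
Lemma commutator_sandwich A B Z : B * A * B = 1 -> Z * A = A * Z ->
  (B * A) * (Z * B - B * Z) + (Z * B - B * Z) * (A * B) = 0.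
Proof.
move=> BAB ZA; rewrite addrC.
rewrite mulrBl mulrBr !mulrA BAB mul1r -(mulrA B Z A) ZA !mulrA subrKA.
by rewrite -(mulrA Z B) -(mulrA Z) BAB mulr1 subrr.
Qed.

Lemma inverse_sqrt_comm A B Z : bnorm (A - 1) <= 16^-1 -> inverse_sqrt A B ->
  Z * A = A * Z -> Z * B = B * Z.
Proof.
move=> A1 [B1 BAB] ZA.
have [BA AB] := inverse_sqrt_half A1 B1.
apply/subr0_eq/(sylvester_inj BA AB).
exact: commutator_sandwich.
Qed.

End InverseSquareRoot.

(** * Intertwining commuting idempotents *)

Section Splice.
Variable A : pzRingType.
Implicit Types p q m n t v s b c : A.

(** The blocks of t that map the range of p to the range of q and the range of
1 - p to that of 1 - q. *)
Definition splice q p t := q * t * p + (1 - q) * t * (1 - p).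

Lemma splice_intertwines q p t : q * q = q -> p * p = p ->
  splice q p t * p = q * splice q p t.
Proof.
move=> qq pp.
have p0 : (1 - p) * p = 0 by rewrite mulrBl mul1r pp subrr.
have q0 : q * (1 - q) = 0 by rewrite mulrBr mulr1 qq subrr.
rewrite /splice [LHS]mulrDl [RHS]mulrDr.
by rewrite -!mulrA pp p0 !mulr0 !mulrA qq q0 !mul0r.
Qed.

(** Splicing preserves what t intertwines already, so two commuting pairs of
idempotents can be spliced one after the other. *)
Lemma splice_transfer q p m n t : m * q = q * m -> n * p = p * n ->
  t * n = m * t -> splice q p t * n = m * splice q p t.
Proof.
move=> mq np tn; have m1q : m * (1 - q) = (1 - q) * m.
  by rewrite mulrBr mulrBl mulr1 mul1r mq.
have n1p : n * (1 - p) = (1 - p) * n by rewrite mulrBr mulrBl mulr1 mul1r np.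
rewrite /splice [LHS]mulrDl [RHS]mulrDr -!mulrA -np -n1p !mulrA mq m1q -!mulrA.
by rewrite !(mulrA t n) !tn !mulrA.
Qed.

Lemma splice_id p : p * p = p -> splice p p 1 = 1.
Proof.
move=> pp; have p0 : p * (1 - p) = 0 by rewrite mulrBr mulr1 pp subrr.
by rewrite /splice !mulr1 pp mulrBl mul1r p0 subr0 subrKC.
Qed.

Lemma conj_mul v (v' : A) m n : v' * v = 1 -> v * m * v' * (v * n * v') = v * (m * n) * v'.
Proof. by move=> v'v; rewrite -!mulrA (mulrA v' v) v'v mul1r. Qed.

(** s * b has the left inverse b * s' by the first equation.  As s * s' is
invertible too, s has a right inverse, hence so does s * b, and the two
inverses agree. *)
Lemma polar_right_inverse s (s' : A) b c : b * (s' * s) * b = 1 ->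
  c * (s * s') * c = 1 -> s * s' * c = c * (s * s') -> s * b * (b * s') = 1 :> A.
Proof.
move=> bs's css' sc.
have u'u : b * s' * (s * b) = 1 by rewrite -bs's !mulrA.
have ux : s * b * (s' * s * b * (s' * c * c)) = 1.
  have -> : s * b * (s' * s * b * (s' * c * c)) =
      s * (b * (s' * s) * b) * s' * c * c by rewrite !mulrA.
  by rewrite bs's mulr1 sc.
by rewrite -[X in _ * X]mulr1 -ux (mulrA (b * s')) u'u mul1r.
Qed.

End Splice.

(** * J-adjoints and polar decomposition *)

Section Jadjoint.
Context (R : realType) (H : hilbertType R) (J : symmetry H).
Local Notation j := (symmetry_op J).
Local Notation "T ^#" := (Jadjoint J T) (at level 2, format "T ^#").
Implicit Types (S T A B P Q U V : 'L(H)).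

Lemma adjointB S T : adjoint (S - T) = adjoint S - adjoint T.
Proof.
apply: adjoint_eq => f g.
by rewrite !bopDE hdotDl hdotDr hdotNl hdotNr !adjointP.
Qed.

Lemma JadjointB S T : (S - T)^# = S^# - T^#.
Proof. by rewrite /Jadjoint adjointB mulrBr mulrBl. Qed.

Lemma bnorm_symmetry : bnorm j <= 1.
Proof.
apply: bnorm_le => // f; rewrite mul1r -(@ler_pXn2r _ 2)// ?nnegrE ?rnorm_ge0//.
rewrite -!rdotff /rdot adjointP symmetry_adjoint.
by rewrite -[j (j f)]/((j * j) f) symmetry_square.
Qed.

Lemma bnorm_adjoint T : bnorm (adjoint T) <= bnorm T.
Proof.
apply: bnorm_le => [|f]; first exact: bnorm_ge0.
set g := adjoint T f.
have [->|g0] := eqVneq (rnorm g) 0; first by rewrite mulr_ge0 ?bnorm_ge0 ?rnorm_ge0.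
have {}g0 : 0 < rnorm g by rewrite lt_neqAle eq_sym g0 rnorm_ge0.
rewrite -(ler_pM2l g0) -expr2 -rdotff {2}/g /rdot -adjointP -/(rdot _ _).
rewrite (le_trans (ler_norm _))// (le_trans (rdot_CS _ _))//.
by rewrite mulrA ler_wpM2r ?rnorm_ge0// mulrC rnorm_bnorm.
Qed.

Lemma bnorm_Jadjoint T : bnorm T^# <= bnorm T.
Proof.
have mulj A B : bnorm A <= 1 -> bnorm (A * B) <= bnorm B.
  by move=> A1; rewrite (le_trans (bnormM _ _))// ler_piMl ?bnorm_ge0.
rewrite /Jadjoint (le_trans (bnormM _ _))//.
rewrite (le_trans (ler_piMr _ bnorm_symmetry)) ?bnorm_ge0//.
by rewrite (le_trans (mulj _ _ bnorm_symmetry))// bnorm_adjoint.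
Qed.

Lemma continuous_Jadjoint (X : topologicalType) (u : X -> 'L(H)) :
  continuous u -> continuous (fun x => (u x)^#).
Proof.
move=> uc x; apply/cvg_bnormP => e e0.
have /cvg_bnormP/(_ e e0) := uc x; apply: filterS => y; apply: le_lt_trans.
by rewrite -JadjointB bnorm_Jadjoint.
Qed.

(** B# solves the same equation as B and is as close to 1. *)
Lemma inverse_sqrt_Jselfadjoint A B : bnorm (A - 1) <= 16^-1 -> inverse_sqrt A B ->
  A^# = A -> B^# = B.
Proof.
move=> A1 AB AA; apply: (inverse_sqrt_unique A1 _ AB).
case: AB => B1 BAB; split.
  by rewrite -(Jadjoint1 J) -JadjointB (le_trans (bnorm_Jadjoint _)).
by rewrite -[X in _ * X * _]AA -mulrA -!JadjointM BAB Jadjoint1.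
Qed.

Lemma idempotent_Jadjoint Q : Q * Q = Q -> Q^# * Q^# = Q^#.
Proof. by rewrite -JadjointM => ->. Qed.

Lemma Jnormal_conjugate P V : Junitary J V -> Jnormal_projection J P ->
  Jnormal_projection J (Jconjugate J P V).
Proof.
move=> [VV' V'V] [PP PP']; rewrite /Jnormal_projection /= /Jconjugate.
have -> : (V * P * V^#)^# = V * P^# * V^# by rewrite 2!JadjointM JadjointK mulrA.
by rewrite !conj_mul// PP PP'.
Qed.

Lemma Jconjugate_comp P U V :
  Jconjugate J P (U * V) = Jconjugate J (Jconjugate J P V) U.
Proof. by rewrite /Jconjugate JadjointM !mulrA. Qed.

(** Expanded, this is the sum of the products of the four idempotents
Q Q#, Q (1 - Q#), (1 - Q) Q#, (1 - Q) (1 - Q#) by the corresponding ones for P. *)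
Definition block_intertwiner Q P : 'L(H) := splice Q P (splice Q^# P^# 1).

Lemma block_intertwiner_id P : Jnormal_projection J P -> block_intertwiner P P = 1.
Proof.
by move=> [PP _]; rewrite /block_intertwiner !splice_id//; exact: idempotent_Jadjoint.
Qed.

Lemma block_intertwinerP Q P : Jnormal_projection J Q -> Jnormal_projection J P ->
  let S := block_intertwiner Q P in S * P = Q * S /\ S * P^# = Q^# * S.
Proof.
move=> [QQ QQ'] [PP PP']; split; first exact: splice_intertwines.
apply: splice_transfer => //.
by apply: splice_intertwines; exact: idempotent_Jadjoint.
Qed.

(** Taking J-adjoints of S P# = Q# S gives P S# = S# Q, so S# S commutes with P.
On an infinite-dimensional space S# S being invertible does not make S
invertible, hence the second bound, on S S#. *)
Lemma Junitary_polar S B Q P : S * P = Q * S -> S * P^# = Q^# * S ->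
  bnorm (S^# * S - 1) <= 16^-1 -> bnorm (S * S^# - 1) <= 16^-1 ->
  inverse_sqrt (S^# * S) B ->
  Junitary J (S * B) /\ Jconjugate J P (S * B) = Q.
Proof.
move=> SP SP' SS1 SS'1 SB.
have B' : B^# = B.
  by apply: (inverse_sqrt_Jselfadjoint SS1 SB); rewrite JadjointM JadjointK.
have PS' : P * S^# = S^# * Q.
  by rewrite -[P in LHS](JadjointK J) -JadjointM SP' JadjointM JadjointK.
have PB : P * B = B * P.
  apply: (inverse_sqrt_comm SS1 SB).
  by rewrite mulrA PS' -[RHS]mulrA SP mulrA.
have [C SC] := inverse_sqrt_exists SS'1.
have comC := inverse_sqrt_comm SS'1 SC (erefl (S * S^# * (S * S^#))).
have UU' : S * B * (S * B)^# = 1.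
  by rewrite JadjointM B'; exact: polar_right_inverse SB.2 SC.2 comC.
have U'U : (S * B)^# * (S * B) = 1.
  by rewrite JadjointM B'; case: SB => _; rewrite !mulrA.
split; first by split.
rewrite /Jconjugate -(mulrA S B P) -PB (mulrA S P) SP -(mulrA Q S B).
by rewrite -(mulrA Q) UU' mulr1.
Qed.

Lemma continuous_splice (X : topologicalType) (u t : X -> 'L(H)) P :
  continuous u -> continuous t -> continuous (fun x => splice (u x) P (t x)).
Proof.
move=> uc tc.
have utP : continuous (fun x => u x * t x * P).
  by apply: continuous_bopM; [exact: continuous_bopM|exact: cst_continuous].
have u'c : continuous (fun x => 1 - u x).
  by move=> x; apply: continuousB; [exact: cst_continuous|exact: uc].
have u'tP' : continuous (fun x => (1 - u x) * t x * (1 - P)).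
  by apply: continuous_bopM; [exact: continuous_bopM|exact: cst_continuous].
by move=> x; exact: continuousD (utP x) (u'tP' x).
Qed.

Lemma continuous_block_intertwiner (X : topologicalType) (q : X -> 'L(H)) P :
  continuous q -> continuous (fun x => block_intertwiner (q x) P).
Proof.
move=> qc; apply: continuous_splice => //.
by apply: continuous_splice; [exact: continuous_Jadjoint|exact: cst_continuous].
Qed.

End Jadjoint.

(** * Local sections and quotient topologies *)

(** Near b, the set W is the preimage under a section of the preimage of W. *)
Lemma open_quotient_of_sections (A B : topologicalType) (p : A -> B) :
  continuous p -> has_local_cross_sections p ->
  forall W : set B, open (p @^-1` W) <-> open W.
Proof.
move=> pc ps W; split=> [pW|oW]; last by apply: open_comp => // x _; exact: pc.
rewrite openE => b Wb; have [N [oN Nb [s sc ps_id]]] := ps b.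
have oNW : open (s @^-1` (p @^-1` W)) by apply: open_comp => // x _; exact: sc.
case: oNW => V oV VE.
rewrite /interior nbhsE; exists (V `&` N); first split.
- exact: openI.
- split=> //.
  suff : (set_val @^-1` V) (SigSub (mem_set Nb) : N) by [].
  by rewrite VE /= ps_id.
- move=> x [Vx Nx].
  have : (s @^-1` (p @^-1` W)) (SigSub (mem_set Nx) : N) by rewrite -VE.
  by rewrite /= ps_id.
Qed.

(** * The orbit of a J-normal projection *)

Section Orbit.
Context (R : realType) (H : hilbertType R) (J : symmetry H) (Q0 : 'L(H)).

Lemma Jorbit_map_continuous : continuous (Jorbit_map J Q0).
Proof.
suff : continuous (fun U : Junitary J => set_val U * Q0 * Jadjoint J (set_val U)).
  by move=> conj_cont; apply: continuous_comp_initial.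
have val_cont : continuous (fun U : Junitary J => set_val U).
  exact: initial_continuous.
apply: continuous_bopM; last exact: continuous_Jadjoint.
by apply: continuous_bopM => //; exact: cst_continuous.
Qed.

Lemma Jorbit_map_sections : Jnormal_projection J Q0 ->
  has_local_cross_sections (Jorbit_map J Q0).
Proof.
move=> nQ0 b.
(* Sections through b are built around b itself and then translated by V. *)
have [V uV VE] := set_valP b.
pose P : 'L(H) := set_val b.
have nJ (q : Jorbit J Q0) : Jnormal_projection J (set_val q).
  by have [U uU UE] := set_valP q; have := Jnormal_conjugate uU nQ0; rewrite UE.
pose S (q : Jorbit J Q0) := block_intertwiner J (set_val q) P.
have val_cont : continuous (fun q : Jorbit J Q0 => set_val q).
  exact: initial_continuous.
have Sc : continuous S by exact: continuous_block_intertwiner.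
have SJc := @continuous_Jadjoint _ _ J _ _ Sc.
pose A q : 'L(H) := Jadjoint J (S q) * S q.
pose A' q : 'L(H) := S q * Jadjoint J (S q).
have Ac : continuous A by exact: continuous_bopM.
have A'c : continuous A' by exact: continuous_bopM.
have Sb : S b = 1 by exact/block_intertwiner_id/nJ.
pose G : set 'L(H) := ball (1 : 'L(H)) (16^-1 : R)%:C.
have GE T : G T -> bnorm (T - 1) <= 16^-1.
  by rewrite /G -ball_normE /ball_/= normr_bnorm ltcR bnorm_distC => /ltW.
have oG : open G by exact: ball_open.
have G1 : G 1 by apply: ballxx; rewrite ltcR; lra.
(* Both S# S and S S# equal 1 at b and are kept close to 1 on W. *)
pose W := A @^-1` G `&` A' @^-1` G.
exists W; split.
- by apply: openI; apply: open_comp.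
- by rewrite /W /A /A' /= Sb Jadjoint1 mulr1.
pose q (w : W) : Jorbit J Q0 := set_val w.
have qc : continuous q by exact: initial_continuous.
have AqG w : bnorm (A (q w) - 1) <= 16^-1 by apply: GE; have [] := set_valP w.
have A'qG w : bnorm (A' (q w) - 1) <= 16^-1 by apply: GE; have [] := set_valP w.
have /choice[B AB] w : exists B, inverse_sqrt (A (q w)) B.
  exact: inverse_sqrt_exists.
have comp_q (u : Jorbit J Q0 -> 'L(H)) : continuous u -> continuous (fun w => u (q w)).
  by move=> uc w; apply: (@continuous_comp _ _ _ q u); [exact: qc|exact: uc].
have Bc : continuous B by apply: continuous_inverse_sqrt AqG AB _; exact: comp_q.
have polar w : Junitary J (S (q w) * B w) /\
    Jconjugate J P (S (q w) * B w) = set_val (q w).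
  have [SP1 SP2] := block_intertwinerP (nJ (q w)) (nJ b).
  exact: Junitary_polar SP1 SP2 (AqG w) (A'qG w) (AB w).
pose s (w : W) : Junitary J := SigSub (mem_set (JunitaryM (polar w).1 uV)).
exists s => [|w]; last first.
  by apply: val_inj; rewrite /= Jconjugate_comp VE (polar w).2.
suff : continuous (fun w => S (q w) * B w * V).
  by move=> SBV_cont; apply: continuous_comp_initial.
apply: continuous_bopM; last exact: cst_continuous.
by apply: continuous_bopM => //; exact: comp_q.
Qed.

End Orbit.

Theorem theorem3p8 (R : realType) (H : hilbertType R)
    (H_separable : separable_space H) (J : symmetry H) (Q0 : 'L(H))
    (Q0_normal : Jnormal_projection J Q0) :
  has_local_cross_sections (Jorbit_map J Q0) /\
  (forall W : set (Jorbit J Q0), Jorbit_quotient_open J Q0 W <-> open W).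
Proof.
have sections := Jorbit_map_sections Q0_normal; split=> // W.
rewrite -(open_quotient_of_sections (@Jorbit_map_continuous _ _ J Q0) sections W).
rewrite /Jorbit_quotient_open /open /= /quotient_open.
suff -> : \pi_(Jcoset_space J Q0)%qT @^-1` (@Jcoset_orbit _ _ J Q0 @^-1` W) =
    Jorbit_map J Q0 @^-1` W by [].
by apply/funext => U /=; rewrite Jcoset_orbit_pi.
Qed.
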